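(* For every $1<p<2$ and every natural number $n\geq 3$, the norms of both injective tensor products $\ell_1\widehat{\otimes}_\varepsilon\ell_p^n$ and $L_1\widehat{\otimes}_\varepsilon\ell_p^n$ fail to be octahedral.
   Context: All Banach spaces are real and non-zero. $L_1$ denotes $L_1[0,1]$; $\ell_p^n$ is $\mathbb{R}^n$ with the $\ell_p$-norm. $X\widehat{\otimes}_\varepsilon Y$ denotes the (completed) injective tensor product. The norm of a Banach space $W$ is octahedral if for every finite-dimensional subspace $E$ of $W$ and every $\varepsilon>0$ there exists $y\in S_W$ (the unit sphere) such that $\|x+\lambda y\|\geq(1-\varepsilon)(\|x\|+|\lambda|)$ for every $x\in E$ and every $\lambda\in\mathbb{R}$. *)

(* Defs.v *)
From HB Require Import structures.
From mathcomp Require Import all_boot all_order all_algebra.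
From mathcomp Require Import ring lra.
From mathcomp Require Import all_classical all_reals all_analysis.
From mathcomp Require Import measurable_realfun.

Set Implicit Arguments.
Unset Strict Implicit.
Unset Printing Implicit Defensive.

Import Order.TTheory GRing.Theory Num.Theory.
Import numFieldNormedType.Exports.

Local Open Scope classical_set_scope.
Local Open Scope ring_scope.

Section Octahedral.
Context {R : realType} {W : normedModType R}.

Definition fin_dim_subspace (E : set W) : Prop :=
  exists m (v : 'I_m -> W),
    E = [set \sum_(i < m) c i *: v i | c in [set: 'I_m -> R]].

Definition octahedral_norm : Prop :=
  forall (E : set W) (eps : R), fin_dim_subspace E -> 0 < eps ->
    exists2 y : W, `|y| = 1 &
      forall (x : W) (l : R), E x ->
        (1 - eps) * (`|x| + `|l|) <= `|x + l *: y|.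

End Octahedral.
Arguments octahedral_norm {R} W.

Section InjectiveTensorProduct.
Context {R : realType}.

(* The closed unit ball of the dual space: linear functionals of norm <= 1. *)
Record dual_ball (X : normedModType R) := DualBall {
  dual_fun :> {linear X -> R^o};
  dual_ballP : forall x, `|dual_fun x| <= `|x| }.

Variables X Y : normedModType R.

(* x (x) y as a function on B_{X*} x B_{Y*} *)
Definition tens (x : X) (y : Y) : dual_ball X * dual_ball Y -> R^o :=
  fun f => f.1 x * f.2 y.

Definition tens_sum (s : seq (X * Y)) : dual_ball X * dual_ball Y -> R^o :=
  \sum_(z <- s) tens z.1 z.2.

Lemma tens_sumE s f : tens_sum s f = \sum_(z <- s) f.1 z.1 * f.2 z.2.
Proof. by rewrite /tens_sum fct_sumE. Qed.

(* The injective norm of u = \sum_i x_i (x) y_i is by definition the supremum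
   of |\sum_i f x_i * g y_i| over f in B_{X*} and g in B_{Y*}: it is the sup
   norm of u seen as a function on B_{X*} x B_{Y*}.  The completion of the
   algebraic tensor product for this norm is therefore its closure for uniform
   convergence. *)
Definition tens_closure : {pred (dual_ball X * dual_ball Y -> R^o)} :=
  fun u => `[< forall e : R, 0 < e ->
    exists s, forall f, `|u f - tens_sum s f| <= e >].

Record injtensor := InjTensor {
  inj_fun :> dual_ball X * dual_ball Y -> R^o;
  inj_funP : inj_fun \in tens_closure }.

HB.instance Definition _ := [isSub for inj_fun].
HB.instance Definition _ := [Choice of injtensor by <:].

Lemma tens_closure_submod : submod_closed tens_closure.
Proof.
split; first by apply/asboolP => e e0; exists [::] => f;
  rewrite tens_sumE big_nil subr0 normr0 ltW.
move=> a u v /asboolP hu /asboolP hv; apply/asboolP => e e0.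
have a0 : 0 < `|a| + 1 by rewrite ltr_wpDl.
have [s hs] := hu (e / 2 / (`|a| + 1)) ltac:(by rewrite !divr_gt0).
have [t ht] := hv (e / 2) ltac:(by rewrite divr_gt0).
exists ([seq (a *: z.1, z.2) | z <- s] ++ t) => f.
have -> : (a *: u + v) f - tens_sum ([seq (a *: z.1, z.2) | z <- s] ++ t) f
    = a * (u f - tens_sum s f) + (v f - tens_sum t f).
  rewrite !tens_sumE big_cat big_map /= mulrBr addrACA -opprD mulr_sumr.
  congr (_ - (_ + _)); apply: eq_bigr => z _.
  by rewrite linearZ /= mulrA.
rewrite (le_trans (ler_normD _ _))// [leRHS](splitr e) lerD// normrM.
rewrite (le_trans (ler_wpM2l (normr_ge0 _) (hs f)))//.
rewrite mulrCA ger_pMr ?divr_gt0// ler_pdivrMr// mul1r.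
by rewrite lerDl.
Qed.

HB.instance Definition _ := GRing.isSubmodClosed.Build R _ tens_closure
  tens_closure_submod.
HB.instance Definition _ := [SubChoice_isSubLmodule of injtensor by <:].

Definition inj_norm (u : injtensor) : R := sup (range (fun f => `|u f|)).

Lemma dual_ball0_subproof (Z : normedModType R) (x : Z) :
  `|(\0 : {linear Z -> R^o}) x| <= `|x|.
Proof. by rewrite normr0. Qed.
Definition dual_ball0 (Z : normedModType R) : dual_ball Z :=
  DualBall (@dual_ball0_subproof Z).

Lemma inj_norm_has_sup (u : injtensor) : has_sup (range (fun f => `|u f|)).
Proof.
split; first by exists `|u (dual_ball0 X, dual_ball0 Y)|, (dual_ball0 X, dual_ball0 Y).
have [s hs] := asboolP _ (inj_funP u) 1 ltr01.
exists (1 + \sum_(z <- s) `|z.1| * `|z.2|) => _ [f _ <-].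
rewrite -(subrK (tens_sum s f) (u f)) (le_trans (ler_normD _ _))// lerD//.
rewrite tens_sumE (le_trans (ler_norm_sum _ _ _))//; apply: ler_sum => z _.
by rewrite normrM ler_pM// dual_ballP.
Qed.

Lemma inj_norm_ub (u : injtensor) f : `|u f| <= inj_norm u.
Proof. by apply: ub_le_sup; [exact: (inj_norm_has_sup u).2|exists f]. Qed.

Lemma inj_norm_le (u : injtensor) M : (forall f, `|u f| <= M) -> inj_norm u <= M.
Proof.
by move=> h; apply: ge_sup; [exact: (inj_norm_has_sup u).1|move=> _ [f _ <-]].
Qed.

Lemma inj_normD u v : inj_norm (u + v) <= inj_norm u + inj_norm v.
Proof.
apply: inj_norm_le => f; rewrite (le_trans (ler_normD _ _))//.
by rewrite lerD// inj_norm_ub.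
Qed.

Lemma inj_normZ (l : R) u : inj_norm (l *: u) = `|l| * inj_norm u.
Proof.
have le1 (k : R) v : inj_norm (k *: v) <= `|k| * inj_norm v.
  apply: inj_norm_le => f.
  by rewrite [X in `|X|](_ : _ = k * v f)// normrM ler_wpM2l// inj_norm_ub.
have [->|l0] := eqVneq l 0.
  rewrite scale0r normr0 mul0r; apply/eqP; rewrite eq_le; apply/andP; split.
    by apply: inj_norm_le => f; rewrite normr0.
  exact: le_trans (normr_ge0 _) (inj_norm_ub 0 (dual_ball0 X, dual_ball0 Y)).
apply/eqP; rewrite eq_le le1/= -[X in _ * inj_norm X](scalerK l0).
rewrite (le_trans (ler_wpM2l (normr_ge0 _) (le1 _ _)))//.
by rewrite mulrA -normrM mulfV// normr1 mul1r.
Qed.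

Lemma inj_norm0_eq0 u : inj_norm u = 0 -> u = 0.
Proof.
move=> u0; apply/val_inj/funext => f /=.
by apply/eqP; rewrite -normr_le0 -u0 inj_norm_ub.
Qed.

HB.instance Definition _ := Lmodule_isNormed.Build R injtensor
  inj_normD inj_normZ inj_norm0_eq0.

Lemma injtensor_complete (F : set_system injtensor) :
  ProperFilter F -> cauchy F -> cvg F.
Proof.
move=> FF Fc.
pose ev f (u : injtensor) : R := u f.
have evB f u v : `|ev f u - ev f v| <= `|u - v|.
  by rewrite (le_trans _ (inj_norm_ub (u - v) f)).
have cvF f : cvg (ev f @ F).
  apply: cauchy_cvg; apply/cauchyP => e e0.
  have /cauchyP/(_ e e0)[u Fu] := Fc.
  exists (ev f u); change (F (ev f @^-1` ball (ev f u) e)).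
  apply: filterS Fu => v; rewrite -!ball_normE /=.
  exact: le_lt_trans (evB f u v).
have key e : 0 < e ->
    exists u, F (ball u e) /\ forall f, `|lim (ev f @ F) - ev f u| <= e.
  move=> e0; have /cauchyP/(_ e e0)[u Fu] := Fc.
  exists u; split=> // f; rewrite ler_distl; apply/andP; split.
    apply: limr_ge => //; apply: filterS Fu => v; rewrite -ball_normE /= => uv.
    by have := le_lt_trans (evB f u v) uv; rewrite ltr_distl => /andP[]; lra.
  apply: limr_le => //; apply: filterS Fu => v; rewrite -ball_normE /= => uv.
  by have := le_lt_trans (evB f u v) uv; rewrite ltr_distl => /andP[]; lra.
pose l : dual_ball X * dual_ball Y -> R^o := fun f => lim (ev f @ F).
have lP : l \in tens_closure.
  apply/asboolP => e e0.
  have [u [_ hu]] := key (e / 2) ltac:(by rewrite divr_gt0).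
  have [s hs] := asboolP _ (inj_funP u) (e / 2) ltac:(by rewrite divr_gt0).
  exists s => f; rewrite [leRHS](splitr e).
  apply: le_trans (ler_distD (u f) _ _) _.
  by apply: lerD; [exact: hu|exact: hs].
apply/cvg_ex; exists (InjTensor lP); apply/cvgrPdist_le => e e0.
have [u [Fu hu]] := key (e / 2) ltac:(by rewrite divr_gt0).
apply: filterS Fu => v; rewrite -ball_normE /= => uv.
apply: inj_norm_le => f; rewrite [leRHS](splitr e).
rewrite [X in `|X|](_ : _ = l f - v f)//.
apply: le_trans (ler_distD (u f) _ _) _.
by apply: lerD; [exact: hu|exact: le_trans (evB f u v) (ltW uv)].
Qed.

HB.instance Definition _ := Uniform_isComplete.Build injtensor injtensor_complete.

Lemma tens_sum_closure s : tens_sum s \in tens_closure.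
Proof. by apply/asboolP => e e0; exists s => f; rewrite subrr normr0 ltW. Qed.

(* The class of \sum_i x_i (x) y_i in the completed tensor product *)
Definition inj_sum s : injtensor := InjTensor (tens_sum_closure s).

Lemma inj_sum_norm s : `|inj_sum s| =
  sup (range (fun f : dual_ball X * dual_ball Y =>
    `|\sum_(z <- s) f.1 z.1 * f.2 z.2|)).
Proof.
rewrite -[LHS]/(inj_norm _) /inj_norm; congr (sup _); apply/eq_imagel => f _.
by rewrite -tens_sumE.
Qed.

Lemma inj_sum_dense u (e : R) : 0 < e -> exists s, `|u - inj_sum s| <= e.
Proof.
move=> e0; have [s hs] := asboolP _ (inj_funP u) e e0.
by exists s; apply: inj_norm_le => f; exact: hs.
Qed.

End InjectiveTensorProduct.

(* The normed space structure on the library's type LspaceType1 mu of classes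
   of mu-integrable real functions modulo equality mu-almost everywhere. *)
Section L1space.
Context d {T : measurableType d} {R : realType}.
Variable mu : {measure set T -> \bar R}.
Local Notation L1 := (LspaceType1 mu).
Implicit Types u v w : L1.

Let intg (f : T -> R) := mu.-integrable [set: T] (EFin \o f).

Let val_L1 u : {mfun_ mu, T >-> measurableTypeR R} := u.

Lemma L1_ext u v : (u : T -> R) = (v : T -> R) %[ae mu] -> u = v.
Proof.
case: u v => [u [[hu]]] [v [[hv]]] /= uv.
have e : u = v.
  rewrite -[u]reprK -[v]reprK; apply/eqmodP/asboolP.
  exact: uv.
by case: _ / e hv => hv; rewrite (Prop_irrelevance hu hv).
Qed.

Lemma L1_integrable u : intg u.
Proof.
apply/integrableP; split; first exact/measurable_EFinP/(measurable_funPT (repr (val_L1 u))).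
by have := @Lebesgue_finite _ _ _ mu _ (lexx 1%E) u; rewrite /finite_norm Lnorm1.
Qed.

Section mk.
Variables (f : T -> R) (If : intg f).

Let mf : @measurable_fun _ _ T (measurableTypeR R) [set: T] f.
Proof. by case/integrableP : If => /measurable_EFinP. Qed.

Let fm : {mfun T >-> measurableTypeR R} :=
  @mfun_Sub _ _ T (measurableTypeR R) f (mem_set mf).

Let cl : {mfun_ mu, T >-> measurableTypeR R} :=
  \pi_({mfun_ mu, T >-> measurableTypeR R})%qT fm.

Let cl_ae : (cl : T -> R) = f %[ae mu].
Proof. by have /eqmodP/asboolP := reprK cl. Qed.

Let cl_finite : finite_norm mu 1 cl.
Proof.
rewrite /finite_norm Lnorm1; case/integrableP : (If) => _.
congr (_ < _)%E; apply: ae_eq_integral => //.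
- by apply: measurableT_comp => //; exact/measurable_EFinP.
- by apply: measurableT_comp => //; exact/measurable_EFinP/(measurable_funPT (repr cl)).
- by apply: filterS cl_ae => x /(_ I) e _ /=; rewrite e.
Qed.

Definition L1_mk : L1.
Proof. by exists cl; do 2 constructor; exact: cl_finite. Defined.

Lemma L1_mkE : (L1_mk : T -> R) = f %[ae mu].
Proof. exact: cl_ae. Qed.

End mk.

Let intgD f g : intg f -> intg g -> intg (f \+ g).
Proof. by move=> If Ig; exact: (integrableD measurableT If Ig). Qed.

Let intgZ a f : intg f -> intg (a \*: f).
Proof. by move=> If; exact: (integrableZl measurableT a If). Qed.

Let intg0 : intg (cst 0).
Proof. exact: integrable0. Qed.

Definition L1_zero : L1 := L1_mk intg0.
Definition L1_add u v : L1 := L1_mk (intgD (L1_integrable u) (L1_integrable v)).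
Definition L1_scale (a : R) u : L1 := L1_mk (intgZ a (L1_integrable u)).
Definition L1_opp u : L1 := L1_scale (-1) u.

Let addE u v : (L1_add u v : T -> R) = u \+ v %[ae mu].
Proof. exact: L1_mkE. Qed.
Let scaleE a u : (L1_scale a u : T -> R) = a \*: (u : T -> R) %[ae mu].
Proof. exact: L1_mkE. Qed.
Let zeroE : (L1_zero : T -> R) = cst 0 %[ae mu].
Proof. exact: L1_mkE. Qed.

Let addA : associative L1_add.
Proof.
move=> u v w; apply: L1_ext; near=> x => _.
rewrite (near (addE u (L1_add v w)) x)//= (near (addE (L1_add u v) w) x)//=.
by rewrite (near (addE u v) x)//= (near (addE v w) x)//= addrA.
Unshelve. all: by end_near. Qed.

Let addC : commutative L1_add.
Proof.
move=> u v; apply: L1_ext; near=> x => _.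
by rewrite (near (addE u v) x)//= (near (addE v u) x)//= addrC.
Unshelve. all: by end_near. Qed.

Let add0 : left_id L1_zero L1_add.
Proof.
move=> u; apply: L1_ext; near=> x => _.
by rewrite (near (addE L1_zero u) x)//= (near zeroE x)//= add0r.
Unshelve. all: by end_near. Qed.

Let addN : left_inverse L1_zero L1_opp L1_add.
Proof.
move=> u; apply: L1_ext; near=> x => _.
rewrite (near (addE (L1_opp u) u) x)//= (near zeroE x)//=.
by rewrite (near (scaleE (-1) u) x)//= scaleN1r addNr.
Unshelve. all: by end_near. Qed.

HB.instance Definition _ := gen_eqMixin L1.
HB.instance Definition _ := gen_choiceMixin L1.
HB.instance Definition _ := GRing.isZmodule.Build L1 addA addC add0 addN.

Let scaleA a b u : L1_scale a (L1_scale b u) = L1_scale (a * b) u.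
Proof.
apply: L1_ext; near=> x => _.
rewrite (near (scaleE a (L1_scale b u)) x)//= (near (scaleE b u) x)//=.
by rewrite (near (scaleE (a * b) u) x)//= scalerA.
Unshelve. all: by end_near. Qed.

Let scale1 : left_id 1 L1_scale.
Proof.
move=> u; apply: L1_ext; near=> x => _.
by rewrite (near (scaleE 1 u) x)//= scale1r.
Unshelve. all: by end_near. Qed.

Let scaleDr : right_distributive L1_scale +%R.
Proof.
move=> a u v; apply: L1_ext; near=> x => _.
rewrite (near (scaleE a (L1_add u v)) x)//= (near (addE u v) x)//=.
rewrite (near (addE (L1_scale a u) (L1_scale a v)) x)//=.
by rewrite (near (scaleE a u) x)//= (near (scaleE a v) x)//= scalerDr.
Unshelve. all: by end_near. Qed.

Let scaleDl u : {morph L1_scale^~ u : a b / a + b}.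
Proof.
move=> a b; apply: L1_ext; near=> x => _.
rewrite (near (scaleE (a + b) u) x)//=.
rewrite (near (addE (L1_scale a u) (L1_scale b u)) x)//=.
by rewrite (near (scaleE a u) x)//= (near (scaleE b u) x)//= scalerDl.
Unshelve. all: by end_near. Qed.

HB.instance Definition _ :=
  GRing.Zmodule_isLmodule.Build R L1 scaleA scale1 scaleDr scaleDl.

Lemma L1_addE u v : (u + v : L1) = (u : T -> R) \+ v %[ae mu].
Proof. exact: addE. Qed.
Lemma L1_scaleE a u : (a *: u : L1) = a \*: (u : T -> R) %[ae mu].
Proof. exact: scaleE. Qed.
Lemma L1_zeroE : ((0 : L1) : T -> R) = cst 0 %[ae mu].
Proof. exact: zeroE. Qed.

Definition L1_norm u : R := fine ('N[mu]_1[EFin \o u])%E.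

Lemma L1_normE u : (L1_norm u)%:E = (\int[mu]_x `|u x|%:E)%E.
Proof.
rewrite /L1_norm fineK ?Lnorm1//; have /integrableP[_ fu] := L1_integrable u.
by rewrite ge0_fin_numE// integral_ge0.
Qed.

Let mabs f : intg f -> measurable_fun [set: T] (fun x => `|f x|%:E).
Proof.
move=> /integrableP[mf _]; apply/measurable_EFinP.
by apply: measurableT_comp => //; exact/measurable_EFinP.
Qed.

Let norm_eq u (f : T -> R) : intg f -> (u : T -> R) = f %[ae mu] ->
  (L1_norm u)%:E = (\int[mu]_x `|f x|%:E)%E.
Proof.
move=> If uf; rewrite L1_normE; apply: ae_eq_integral => //.
- exact/mabs/L1_integrable.
- exact: mabs.
- by apply: filterS uf => x /(_ I) e _ /=; rewrite e.
Qed.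

Let normD u v : L1_norm (u + v) <= L1_norm u + L1_norm v.
Proof.
have Iuv := intgD (L1_integrable u) (L1_integrable v).
rewrite -lee_fin EFinD (norm_eq Iuv (L1_addE u v)) !L1_normE.
have mU := mabs (L1_integrable u); have mV := mabs (L1_integrable v).
rewrite -ge0_integralD//; apply: ge0_le_integral => //; last first.
  by move=> x _; rewrite -EFinD lee_fin ler_normD.
  exact: emeasurable_funD.
exact: mabs.
Qed.

Let normZ a u : L1_norm (a *: u) = `|a| * L1_norm u.
Proof.
apply: EFin_inj; rewrite EFinM.
rewrite (norm_eq (intgZ a (L1_integrable u)) (L1_scaleE a u)) L1_normE.
rewrite -ge0_integralZl//; last exact/mabs/L1_integrable.
by apply: eq_integral => x _; rewrite -EFinM -normrM.
Qed.

Let norm0 u : L1_norm u = 0 -> u = 0.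
Proof.
move=> u0; have := L1_normE u; rewrite u0 => /esym uz.
have /integrableP[mu' _] := L1_integrable u.
have /(ae_eq_integral_abs mu measurableT mu') h := uz.
have u_ae0 : (u : T -> R) = cst 0 %[ae mu].
  by apply: filterS h => x /(_ I) [ux0] _.
exact: L1_ext (ae_eq_trans u_ae0 (ae_eq_sym L1_zeroE)).
Qed.

HB.instance Definition _ := Lmodule_isNormed.Build R L1 normD normZ norm0.

End L1space.

Definition ell1 (R : realType) : normedModType R := LspaceType1 (@counting nat R).

Lemma ell1_ext (R : realType) (u v : ell1 R) :
  (u : nat -> R) =1 (v : nat -> R) -> u = v.
Proof. by move=> uv; apply: L1_ext; apply/nearW => k _; exact: uv. Qed.

Lemma ell1_normE (R : realType) (u : ell1 R) :
  (`|u|%:E = \sum_(k <oo) `|(u : nat -> R) k|%:E)%E.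
Proof. by rewrite L1_normE ge0_integral_count. Qed.

(* The restricted measure ignores the complement of [0, 1], so that a class is
   determined by the values of a function on [0, 1]. *)
Definition L1_01 (R : realType) : normedModType R :=
  LspaceType1 (mrestr (@lebesgue_measure R) (measurable_itv `[0%R, 1%R])).

(* R^n with the l_p norm.  An alias of 'rV[R]_n is needed because 'rV[R]_n
   itself canonically carries the sup norm. *)
Definition lpn (R : realType) (p : R) (p1 : 1 <= p) (n : nat) : Type := 'rV[R]_n.

Section LpnNorm.
Context {R : realType} {p : R} (p1 : 1 <= p) (n : nat).

HB.instance Definition _ := GRing.Lmodule.copy (lpn p1 n) 'rV[R]_n.

Implicit Types x y : lpn p1 n.

Definition lpn_norm x : R := (\sum_(i < n) `|x 0 i| `^ p) `^ p^-1.

Let p0 : 0 < p. Proof. exact: lt_le_trans p1. Qed.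

Let S x : R := \sum_(i < n) `|x 0 i| `^ p.

Let S_ge0 x : 0 <= S x.
Proof. by apply: sumr_ge0 => i _; exact: powR_ge0. Qed.

Let norm_ge0 x : 0 <= lpn_norm x. Proof. exact: powR_ge0. Qed.

Let normp x : lpn_norm x `^ p = S x.
Proof. by rewrite /lpn_norm -powRrM mulVf ?powRr1 ?S_ge0// gt_eqF. Qed.

Let norm0 x : lpn_norm x = 0 -> x = 0.
Proof.
move=> x0; have := normp x; rewrite x0 powR0 ?gt_eqF// => /esym/eqP.
rewrite psumr_eq0 => [/allP h|i _]; last exact: powR_ge0.
apply/rowP => i; have := h i (mem_index_enum _).
by rewrite /= powR_eq0 normr_eq0 (gt_eqF p0) andbT mxE => /eqP.
Qed.

Let normZ a x : lpn_norm (a *: x) = `|a| * lpn_norm x.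
Proof.
rewrite /lpn_norm (_ : \sum_(i < n) _ = `|a| `^ p * S x).
  by rewrite powRM ?powR_ge0// -powRrM mulfV ?gt_eqF// powRr1.
rewrite mulr_sumr; apply: eq_bigr => i _.
by rewrite mxE normrM powRM.
Qed.

Let fieldE (a b u v : R) : a != 0 -> b != 0 -> a + b != 0 ->
  u + v = (a + b) * (a / (a + b) * (u / a) + b / (a + b) * (v / b)).
Proof. by move=> *; field; do ?[apply/andP; split]. Qed.

Let fieldB (a b : R) : a + b != 0 -> 1 - a / (a + b) = b / (a + b).
Proof. by move=> ?; field. Qed.

Let minkowski_pos x y (a b : R) : 0 < a -> 0 < b ->
  S x = a `^ p -> S y = b `^ p -> S (x + y) <= (a + b) `^ p.
Proof.
move=> a0 b0 Sa Sb; have ab0 : 0 < a + b by rewrite addr_gt0.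
have [aw bw abw pw] : [/\ 0 <= a, 0 <= b, 0 <= a + b & 0 <= p].
  by split; exact: ltW.
have t0 : 0 <= a / (a + b) by exact: divr_ge0.
have t1 : a / (a + b) <= 1 by rewrite ler_pdivrMr// mul1r lerDl.
have t1' : 0 <= b / (a + b) by exact: divr_ge0.
have conv u v : 0 <= u -> 0 <= v ->
    (a / (a + b) * u + b / (a + b) * v) `^ p <=
    a / (a + b) * u `^ p + b / (a + b) * v `^ p.
  move=> u0 v0; rewrite -(fieldB (lt0r_neq0 ab0)).
  apply: (convex_powR p1 (Itv01 t0 t1)) => //=.
    by rewrite inE/= in_itv/= u0.
  by rewrite inE/= in_itv/= v0.
apply: (@le_trans _ _ (\sum_(i < n) (a + b) `^ p *
    (a / (a + b) * (`|x 0 i| / a) `^ p + b / (a + b) * (`|y 0 i| / b) `^ p))).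
  apply: ler_sum => i _; rewrite mxE.
  apply: (@le_trans _ _ ((`|x 0 i| + `|y 0 i|) `^ p)).
    by rewrite ge0_ler_powR ?nnegrE ?addr_ge0 ?ler_normD.
  have xa : 0 <= `|x 0 i| / a by exact: divr_ge0.
  have yb : 0 <= `|y 0 i| / b by exact: divr_ge0.
  rewrite (@fieldE a b `|x 0 i| `|y 0 i|) ?lt0r_neq0// powRM//; last first.
    by apply: addr_ge0; exact: mulr_ge0.
  by rewrite ler_pM2l ?powR_gt0//; exact: (conv _ _ xa yb).
rewrite -mulr_sumr big_split/= -!mulr_sumr.
have sE (z : lpn p1 n) (c : R) : 0 < c -> S z = c `^ p ->
    \sum_(i < n) (`|z 0 i| / c) `^ p = 1.
  move=> c0 Sz; have cw : 0 <= c^-1 by rewrite invr_ge0 ltW.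
  under eq_bigr do rewrite powRM//.
  rewrite -mulr_suml -/(S z) Sz -powRM//; last exact: ltW.
  by rewrite mulfV ?lt0r_neq0// powR1.
rewrite !sE// !mulr1 -mulrDl mulfV ?lt0r_neq0// mulr1.
exact: lexx.
Qed.

Let normD x y : lpn_norm (x + y) <= lpn_norm x + lpn_norm y.
Proof.
have [/norm0->|x0] := eqVneq (lpn_norm x) 0; first by rewrite add0r lerDr.
have [/norm0->|y0] := eqVneq (lpn_norm y) 0; first by rewrite addr0 lerDl.
have a0 : 0 < lpn_norm x by rewrite lt_def x0 norm_ge0.
have b0 : 0 < lpn_norm y by rewrite lt_def y0 norm_ge0.
have ab0 := addr_ge0 (norm_ge0 x) (norm_ge0 y).
rewrite leNgt; apply/negP => h.
have := gt0_ltr_powR p0 ab0 (norm_ge0 (x + y)) h.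
rewrite normp ltNge => /negP; apply.
apply: (minkowski_pos a0 b0); apply: esym; exact: normp.
Qed.

HB.instance Definition _ :=
  Lmodule_isNormed.Build R (lpn p1 n) normD normZ norm0.

End LpnNorm.

(* Main.v *)
From HB Require Import structures.
Require Import Defs.
From mathcomp Require Import all_boot all_order all_algebra.
From mathcomp Require Import ring lra.
From mathcomp Require Import all_classical all_reals all_analysis.
From mathcomp Require Import measurable_realfun.

Set Implicit Arguments.
Unset Strict Implicit.
Unset Printing Implicit Defensive.

Import Order.TTheory GRing.Theory Num.Theory.
Import numFieldNormedType.Exports.
Local Open Scope classical_set_scope.
Local Open Scope ring_scope.

(* Let X be L_1(mu), q the exponent conjugate to p, and suppose that the norm
   of X (x) l_p^n is octahedral. Fix x0 in S_X, apply octahedrality to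
   E = x0 (x) l_p^n, and view the resulting u as an operator l_q^n -> X,
   a |-> \sum_i a_i w_i. For a in the sphere of l_q^n, normed by y in l_p^n,
   the norm of x0 (x) y + u is almost 2, so it is almost attained at some f (x) g
   with g(y) and the norm of g(u) both almost 1; since l_p^n is smooth, g is
   close to a. So l_q^n embeds almost isometrically in X.
   This is impossible for q > 2 and n >= 3. Over the O(N) points v = (1, s), (s, 1)
   of the (e_1, e_2)-plane, with s in a grid of step 1/N of [-1, 1], sum
   the second differences |v + t e_3| + |v - t e_3| - 2 |v|. In l_q^n the sum is
   O(N t^q). For real numbers xi it is at least 2 (t |xi_3| - (|xi_1| + |xi_2|) / N),
   as some v is almost orthogonal to xi, and integration carries this over
   to X. With t = 4/N this forces 1/N = O(N^(1-q)). *)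

(** * Norms in L_1(mu): norming functionals and inequalities inherited from the scalars *)

Section L1.
Context d {T : measurableType d} {R : realType}.
Variable mu : {measure set T -> \bar R}.
Local Notation L1 := (LspaceType1 mu).

Lemma L1_integrableS (D : set T) (u : L1) : measurable D ->
  mu.-integrable D (EFin \o u).
Proof. by move=> mD; exact: integrableS (L1_integrable u). Qed.

Lemma ae_eq_Rintegral (D : set T) (f g : T -> R) : measurable D ->
  measurable_fun D f -> measurable_fun D g -> f = g %[ae mu] ->
  \int[mu]_(x in D) f x = \int[mu]_(x in D) g x.
Proof.
move=> mD mf mg fg; congr fine; apply: ae_eq_integral => //.
- exact/measurable_EFinP.
- exact/measurable_EFinP.
by apply: filterS fg => x /(_ I) e _ /=; rewrite e.
Qed.

Lemma L1_Rintegral_linear (D : set T) : measurable D ->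
  linear (fun u : L1 => \int[mu]_(x in D) (u : T -> R) x : R^o).
Proof.
move=> mD a u v.
have mf (w : L1) : measurable_fun D (w : T -> R).
  by case/integrableP : (L1_integrableS w mD) => /measurable_EFinP.
have au := integrableZl mD a (L1_integrableS u mD).
transitivity (\int[mu]_(x in D) (a * (u : T -> R) x + (v : T -> R) x)).
  apply: ae_eq_Rintegral => //.
    by apply: measurable_funD => //; exact: measurable_funM.
  near=> x => _; rewrite (near (L1_addE (a *: u) v) x)//=.
  by rewrite (near (L1_scaleE a u) x).
rewrite RintegralD ?RintegralZl//; exact: L1_integrableS.
Unshelve. all: by end_near. Qed.

Lemma L1_normRE (u : L1) : `|u| = \int[mu]_x `|(u : T -> R) x|.
Proof. by rewrite /Rintegral -(L1_normE u). Qed.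

(** The functional is integration against the sign of [u], written as a difference of integrals over
    [A] and its complement. *)
Lemma L1_norming (u : L1) : exists f : dual_ball L1, f u = `|u|.
Proof.
pose A := [set x | 0 <= (u : T -> R) x].
have mA : measurable A.
  have /integrableP[/measurable_EFinP mu_ _] := L1_integrable u.
  by rewrite -[A]setTI; exact: measurable_fun_le.
have mA' := measurableC mA.
have absS (v : L1) : `|v| = \int[mu]_(x in A) `|(v : T -> R) x|
    + \int[mu]_(x in ~` A) `|(v : T -> R) x|.
  rewrite L1_normRE -Rintegral_setU ?setUv//.
    exact: (integrable_norm (L1_integrable v)).
  by apply/disj_setPS; rewrite setICr.
pose f (v : L1) : R^o := \int[mu]_(x in A) (v : T -> R) x
  - \int[mu]_(x in ~` A) (v : T -> R) x.
have lf : linear f.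
  move=> a v w; rewrite /f !L1_Rintegral_linear// scalerBr.
  by rewrite opprD addrACA.
pose F : {linear L1 -> R^o} :=
  HB.pack f (GRing.isLinear.Build R L1 R^o *:%R f lf).
have F1 v : `|F v| <= `|v|.
  rewrite absS (le_trans (ler_normB _ _))// lerD// le_normr_Rintegral//;
    exact: L1_integrableS.
exists (DualBall F1); rewrite absS /= /f; congr (_ + _).
  by apply: eq_Rintegral => x; rewrite inE /A/= => ux; rewrite ger0_norm.
rewrite -mulN1r -RintegralZl//; last exact: L1_integrableS.
apply: eq_Rintegral => x; rewrite inE /A/= => /negP; rewrite -ltNge => ux.
by rewrite ltr0_norm// mulN1r.
Qed.

Lemma L1_sumE (J : Type) (s : seq J) (a : J -> R) (w : J -> L1) :
  ((\sum_(j <- s) a j *: w j : L1) : T -> R)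
    = (fun x => \sum_(j <- s) a j * (w j : T -> R) x) %[ae mu].
Proof.
elim: s => [|j s IH].
  rewrite big_nil; apply: filterS (L1_zeroE mu) => x H _.
  by rewrite H// big_nil.
rewrite big_cons; near=> x => _; rewrite big_cons.
rewrite (near (L1_addE (a j *: w j) (\sum_(j <- s) a j *: w j)) x)//=.
by rewrite (near (L1_scaleE (a j) (w j)) x)//= (near IH x).
Unshelve. all: by end_near. Qed.

(** Taking for [xi] the values of the [w j] at a point and integrating over all points turns the
    scalar inequality into one between norms. *)
Lemma L1_norm_lincomb_ge0 (I J : Type) (s : seq I) (r : seq J) (c : I -> R)
    (a : I -> J -> R) (w : J -> L1) :
  (forall xi : J -> R,
    0 <= \sum_(i <- s) c i * `|\sum_(j <- r) a i j * xi j|) ->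
  0 <= \sum_(i <- s) c i * `|\sum_(j <- r) a i j *: w j|.
Proof.
move=> ac; pose v i x := \sum_(j <- r) a i j * (w j : T -> R) x.
have iv i : mu.-integrable setT (EFin \o v i).
  rewrite (_ : _ \o _ = fun x => (\sum_(j <- r) (a i j * (w j : T -> R) x)%:E)%E);
    last by apply/funext => x /=; rewrite sumEFin.
  apply: integrable_sum => [|j _]; first exact: measurableT.
  exact: (integrableZl measurableT (a i j) (L1_integrable (w j))).
have civ i : mu.-integrable setT (EFin \o (fun x => c i * `|v i x|)).
  by have := integrableZl measurableT (c i) (integrable_norm (iv i)).
have sciv t : mu.-integrable setT (EFin \o (fun x => \sum_(i <- t) c i * `|v i x|)).
  rewrite (_ : _ \o _ = fun x => (\sum_(i <- t) (c i * `|v i x|)%:E)%E);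
    last by apply/funext => x /=; rewrite sumEFin.
  by apply: integrable_sum => [|i _]; [exact: measurableT|exact: civ].
have -> : \sum_(i <- s) c i * `|\sum_(j <- r) a i j *: w j| =
    \int[mu]_x (\sum_(i <- s) c i * `|v i x|).
  elim: s {ac} => [|i s IH].
    by under eq_Rintegral do rewrite big_nil; rewrite Rintegral_cst// mul0r big_nil.
  under eq_Rintegral do rewrite big_cons.
  rewrite big_cons IH RintegralD//; congr (_ + _).
  have nv := integrable_norm (iv i).
  have nL := integrable_norm (L1_integrable (\sum_(j <- r) a i j *: w j)).
  rewrite L1_normRE RintegralZl//; congr (_ * _); apply: ae_eq_Rintegral => //.
  - by case/integrableP : nL => /measurable_EFinP.
  - by case/integrableP : nv => /measurable_EFinP.
  by apply: filterS (L1_sumE r (a i) w) => x H _; rewrite H.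
by apply: Rintegral_ge0 => x _; exact: ac.
Qed.
End L1.

(** * Estimates for powers of real numbers *)

Section powR_inequalities.
Context {R : realType}.
Implicit Types p q r b x y z : R.

(** A part z of the total s = x + y satisfies z / s <= (z / s)^r because z / s <= 1 and r <= 1; the
    two parts add up to s. *)
Lemma powR_add_le r x y : 0 < r -> r <= 1 -> 0 <= x -> 0 <= y ->
  (x + y) `^ r <= x `^ r + y `^ r.
Proof.
move=> r0 r1; rewrite le_eqVlt => /predU1P[<- _|x0].
  by rewrite add0r powR0 ?gt_eqF// add0r.
rewrite le_eqVlt => /predU1P[<-|y0].
  by rewrite addr0 powR0 ?gt_eqF// addr0.
have xy0 : 0 < x + y by rewrite addr_gt0.
have le_part z : 0 < z -> z <= x + y -> z / (x + y) * (x + y) `^ r <= z `^ r.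
  move=> z0 zxy; have z1 : z / (x + y) <= 1 by rewrite ler_pdivrMr// mul1r.
  have zp : 0 < z / (x + y) by exact: divr_gt0.
  rewrite -[X in _ <= X `^ r](divfK (lt0r_neq0 xy0) z) powRM ?(ltW xy0) ?(ltW zp)//.
  by rewrite ler_pM2r ?powR_gt0// ger1_powR// zp.
apply: le_trans (lerD (le_part x x0 _) (le_part y y0 _)).
- by rewrite -mulrDl -mulrDl mulfV ?gt_eqF// mul1r.
- by rewrite lerDl ltW.
- by rewrite lerDr ltW.
Qed.

(** For r = p - 1 this is the derivative of |z|^p / p, hence the coordinate map of the duality
    between l_p^n and l_q^n. *)
Definition sgpow r z := Num.sg z * `|z| `^ r.

Lemma sgpowN r z : sgpow r (- z) = - sgpow r z.
Proof. by rewrite /sgpow sgrN normrN mulNr. Qed.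

Lemma ge0_sgpow r z : 0 < r -> 0 <= z -> sgpow r z = z `^ r.
Proof.
move=> r0; rewrite le_eqVlt => /predU1P[<-|z0].
  by rewrite /sgpow normr0 powR0 ?gt_eqF// mulr0.
by rewrite /sgpow gtr0_sg// mul1r gtr0_norm.
Qed.

(** Symmetry and oddness reduce to y <= x with x >= 0. For equal signs subadditivity gives the
    constant 1; for opposite signs each power is at most |x - y|^r, whence the 2. *)
Lemma sgpow_holder r x y : 0 < r -> r <= 1 ->
  `|sgpow r x - sgpow r y| <= 2 * `|x - y| `^ r.
Proof.
move=> r0 r1; wlog : x y / y <= x.
  move=> H; have [|/ltW] := leP y x; first exact: H.
  by rewrite distrC (distrC x); exact: H.
move=> yx; wlog x0 : x y yx / 0 <= x.
  move=> H; have [|x0] := leP 0 x; first exact: H.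
  rewrite (_ : x - y = - y - - x); last by ring.
  rewrite (_ : sgpow r x - sgpow r y = sgpow r (- y) - sgpow r (- x));
    last by rewrite !sgpowN; ring.
  by apply: H; lra.
have [y0|/ltW y0] := leP 0 y.
  rewrite !ge0_sgpow// ger0_norm ?subr_ge0//; last first.
    by rewrite ge0_ler_powR// ltW.
  rewrite ger0_norm ?subr_ge0// lerBlDr.
  rewrite -[x in leLHS](subrK y) (le_trans (powR_add_le _ _ _ _))// ?subr_ge0//.
  by rewrite lerD2r ler_peMl ?powR_ge0// ler1n.
have y0' : 0 <= - y by rewrite oppr_ge0.
have xy0 : 0 <= x - y by lra.
rewrite -[in sgpow r y](opprK y) sgpowN opprK !ge0_sgpow//.
rewrite ger0_norm ?addr_ge0 ?powR_ge0// (ger0_norm xy0) mulr_natl mulr2n.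
by rewrite lerD// ge0_ler_powR ?nnegrE//; lra.
Qed.

Variables (p q : R).
Hypotheses (p1 : 1 < p) (pq : p^-1 + q^-1 = 1).

Let p0 : 0 < p. Proof. exact: lt_trans p1. Qed.

Lemma conj_powR_gt0 : 0 < q.
Proof.
by rewrite -invr_gt0 -(addKr p^-1 q^-1) pq addrC subr_gt0 invf_lt1.
Qed.

Lemma conj_powR_exp : (p - 1) * q = p.
Proof.
have qn0 := lt0r_neq0 conj_powR_gt0; have pn0 := lt0r_neq0 p0.
have : (p^-1 + q^-1) * (p * q) = q + p by field; rewrite pn0 qn0.
by rewrite pq mul1r mulrBl mul1r => ->; rewrite addrC addKr.
Qed.

(** Young's inequality with second factor 1. It trades a norm for its p-th power, which splits over
    coordinates. *)
Lemma powR_ge_id x : 0 <= x -> x <= x `^ p / p + q^-1.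
Proof.
move=> x0; have := conjugate_powR x0 ler01 p0 conj_powR_gt0 pq.
by rewrite mulr1 powR1 mul1r.
Qed.

(** Convexity of |.|^p: the tangent at [z] lies below the graph at [b]. Young's inequality for |b|
    |z|^(p-1) yields it. *)
Lemma normr_powR_tangent b z :
  `|z| `^ p <= `|b| `^ p + p * sgpow (p - 1) z * (z - b).
Proof.
have q0 := conj_powR_gt0.
have := conjugate_powR (normr_ge0 b) (powR_ge0 `|z| (p - 1)) p0 q0 pq.
rewrite -powRrM conj_powR_exp => yg.
have zz : sgpow (p - 1) z * z = `|z| `^ p.
  by rewrite /sgpow mulrAC -normrEsg mulr_powRB1.
have zb : sgpow (p - 1) z * b <= `|b| * `|z| `^ (p - 1).
  rewrite (le_trans (ler_norm _))// /sgpow normrM normrM (ger0_norm (powR_ge0 _ _)).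
  rewrite mulrC ler_wpM2l// ler_piMl ?powR_ge0//.
  by rewrite normr_sg; case: (z != 0).
rewrite -mulrA mulrBr zz.
have qi : q^-1 = 1 - p^-1 by rewrite -pq [RHS]addrC addKr.
rewrite qi in yg.
have := ler_wpM2l (ltW p0) (le_trans zb yg).
rewrite (_ : p * (_ + _) = `|b| `^ p + (p - 1) * `|z| `^ p); first by lra.
by field; exact: lt0r_neq0.
Qed.

(** The left side bounds the norm of y + s e_i for a unit vector y with y_i = b. The tangent at b +
    s controls the increment, and the Hoelder estimate moves the derivative back to b at the cost 2
    |s| t^(p-1) = 2 t^p. *)
Lemma powR_young_smooth b s t : p <= 2 -> `|s| = t ->
  (1 + (`|b + s| `^ p - `|b| `^ p)) / p + q^-1 <=
  1 + s * sgpow (p - 1) b + 2 * t `^ p.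
Proof.
move=> p2 st; have t0 : 0 <= t by rewrite -st.
have r0 : 0 < p - 1 by rewrite subr_gt0.
have r1 : p - 1 <= 1 by rewrite lerBlDr.
have tang := normr_powR_tangent b (b + s).
have hol := sgpow_holder (b + s) b r0 r1.
rewrite addrAC subrr add0r in tang; rewrite addrAC subrr add0r st in hol.
have hs : s * (sgpow (p - 1) (b + s) - sgpow (p - 1) b) <= 2 * t `^ p.
  rewrite (le_trans (ler_norm _))// normrM st -(mulr_powRB1 t0 p0) mulrCA.
  by rewrite ler_wpM2l.
have -> : q^-1 = 1 - p^-1 by rewrite -pq [RHS]addrC addKr.
have pn0 := lt0r_neq0 p0.
set A := `|b + s| `^ p in tang *; set B := `|b| `^ p in tang *.
rewrite (_ : _ + _ = 1 + (A - B) / p); last by field.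
rewrite -addrA lerD2l ler_pdivrMr//.
apply: (@le_trans _ _ (s * sgpow (p - 1) (b + s) * p)); first by lra.
by rewrite ler_pM2r//; lra.
Qed.

End powR_inequalities.

(** * The norm of l_p^n, its duality with l_q^n, and its smoothness *)

Section lpn_norm.
Context {R : realType} {p : R} (p1 : 1 <= p) (n : nat).
Implicit Types x y : lpn p1 n.

Let p0 : 0 < p. Proof. exact: lt_le_trans p1. Qed.

Lemma lpn_normp x : `|x| `^ p = \sum_(i < n) `|x 0 i| `^ p.
Proof.
rewrite -[`|x|]/(lpn_norm x) /lpn_norm -powRrM mulVf ?gt_eqF// powRr1//.
by apply: sumr_ge0 => i _; exact: powR_ge0.
Qed.

Lemma lpn_norm_eq x (r : R) : 0 <= r ->
  \sum_(i < n) `|x 0 i| `^ p = r `^ p -> `|x| = r.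
Proof.
move=> r0; rewrite -lpn_normp => /(powR_injective p0); apply.
  by rewrite nnegrE.
by rewrite nnegrE.
Qed.

Definition lpn_delta (i : 'I_n) : lpn p1 n := delta_mx 0 i.

Lemma lpn_norm_delta i : `|lpn_delta i| = 1.
Proof.
apply: lpn_norm_eq => //; rewrite powR1 (bigD1 i)//= big1 ?addr0.
  by rewrite mxE !eqxx normr1 powR1.
by move=> j /negPf ji; rewrite mxE ji andbF normr0 powR0 ?gt_eqF.
Qed.

Lemma lpn_sum_delta x : x = \sum_(i < n) x 0 i *: lpn_delta i.
Proof. exact: row_sum_delta. Qed.

End lpn_norm.

Section lpn_duality.
Context {R : realType} {p q : R} (n : nat).
Hypotheses (p1 : 1 < p) (p2 : p <= 2) (pq : p^-1 + q^-1 = 1).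
Variable q1 : 1 <= q.
Local Notation Y := (lpn (ltW p1) n).
Local Notation Yd := (lpn q1 n).

Let p0 : 0 < p. Proof. exact: lt_trans p1. Qed.
Let q0 : 0 < q. Proof. exact: lt_le_trans q1. Qed.

Lemma lpn_hoelder (a : Yd) (y : Y) :
  `|\sum_(i < n) a 0 i * y 0 i| <= `|a| * `|y|.
Proof.
have [->|a0] := eqVneq a 0.
  by rewrite normr0 mul0r big1 ?normr0// => i _; rewrite mxE mul0r.
have [->|y0] := eqVneq y 0.
  by rewrite normr0 mulr0 big1 ?normr0// => i _; rewrite mxE mulr0.
have A0 : 0 < `|a| by rewrite normr_gt0.
have Y0 : 0 < `|y| by rewrite normr_gt0.
have Aq := lpn_normp a; have Yp := lpn_normp y.
move: (`|a|) (`|y|) A0 Y0 Aq Yp => A B A0 B0 Aq Bp.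
rewrite -[leRHS]mul1r -ler_pdivrMr ?mulr_gt0//.
have nx (z : R) (N : R) s : 0 < N -> 0 < s -> (`|z| / N) `^ s = `|z| `^ s / N `^ s.
  move=> N0 s0; rewrite powRM ?invr_ge0 ?(ltW N0)//; congr (_ * _).
  by rewrite -(powR_inv1 (ltW N0)) powRAC powR_inv1 ?powR_ge0.
have AB0 : 0 <= (A * B)^-1 by rewrite invr_ge0 mulr_ge0 ?ltW.
apply: (le_trans (ler_wpM2r AB0 (ler_norm_sum _ _ _))).
rewrite mulr_suml (@le_trans _ _ (\sum_(i < n)
    ((`|y 0 i| / B) `^ p / p + (`|a 0 i| / A) `^ q / q)))//.
  apply: ler_sum => i _; rewrite normrM invfM mulrACA mulrC.
  by apply: conjugate_powR => //; rewrite divr_ge0// ltW.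
rewrite big_split/= -!mulr_suml.
under eq_bigr do rewrite nx//.
rewrite -mulr_suml -Bp divff ?gt_eqF ?powR_gt0//.
under eq_bigr do rewrite nx//.
by rewrite -mulr_suml -Aq divff ?gt_eqF ?powR_gt0// !mul1r pq.
Qed.

Definition lpn_form (a : Yd) (y : Y) : R^o := \sum_(i < n) a 0 i * y 0 i.

Lemma lpn_form_linear a : linear (lpn_form a).
Proof.
move=> k x y; rewrite /lpn_form scaler_sumr -big_split; apply: eq_bigr => i _.
by rewrite !mxE mulrDr mulrCA.
Qed.

HB.instance Definition _ a :=
  GRing.isLinear.Build R Y R^o *:%R (lpn_form a) (lpn_form_linear a).

Lemma lpn_form_le a : `|a| = 1 -> forall y, `|lpn_form a y| <= `|y|.
Proof. by move=> a1 y; rewrite (le_trans (lpn_hoelder _ _))// a1 mul1r. Qed.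

Definition lpn_dual a (a1 : `|a| = 1) : dual_ball Y := DualBall (lpn_form_le a1).

(** The duality map: for [a] on the sphere of l_q^n this is the unit vector of l_p^n normed by
    [a]. *)
Definition dual_vec (a : Yd) : Y := \row_i sgpow (q - 1) (a 0 i).

Let qp : q^-1 + p^-1 = 1. Proof. by rewrite addrC. Qed.
Let q1' : 1 < q. Proof. by rewrite -invf_lt1// -qp ltrDl invr_gt0. Qed.

Lemma norm_dual_vec a : `|a| = 1 -> `|dual_vec a| = 1.
Proof.
move=> a1; apply: lpn_norm_eq => //; rewrite powR1.
transitivity (`|a| `^ q); last by rewrite a1 powR1.
rewrite lpn_normp; apply: eq_bigr => i _.
rewrite mxE /sgpow normrM (ger0_norm (powR_ge0 _ _)) normr_sg.
have [->|ai0] := eqVneq (a 0 i) 0.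
  by rewrite normr0 mul0r !powR0// gt_eqF.
by rewrite mul1r -powRrM (conj_powR_exp q1' qp).
Qed.

Lemma lpn_form_dual_vec a : `|a| = 1 -> lpn_form a (dual_vec a) = 1.
Proof.
move=> a1; transitivity (`|a| `^ q); last by rewrite a1 powR1.
rewrite lpn_normp; apply: eq_bigr => i _; rewrite mxE /sgpow mulrA.
by rewrite [a 0 i * _]mulrC -normrEsg mulr_powRB1.
Qed.

(** The two duality maps are inverse to each other because (q - 1)(p - 1) = 1. *)
Lemma sgpow_dual_vec a i : sgpow (p - 1) (dual_vec a 0 i) = a 0 i.
Proof.
rewrite mxE /sgpow; have [->|ai0] := eqVneq (a 0 i) 0.
  by rewrite sgr0 mul0r sgr0 mul0r.
have e : (q - 1) * (p - 1) = 1.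
  rewrite mulrBr mulr1 mulrC mulrBr mulr1 (mulrC p).
  by have := conj_powR_exp p1 pq; lra.
rewrite normrM (ger0_norm (powR_ge0 _ _)) normr_sg ai0.
rewrite mul1r -powRrM e powRr1// sgrM sgr_id [Num.sg (_ `^ _)]gtr0_sg ?mulr1.
  by rewrite -numEsg.
by rewrite powR_gt0// normr_gt0.
Qed.

(* Test c on y + t e_i and y - t e_i, whose norms exceed their first-order
   approximations by at most 2 t^p. *)
Lemma lpn_smooth (y : Y) (c : 'I_n -> R) (t : R) : 0 < t -> `|y| = 1 ->
  (forall z : Y, \sum_(i < n) c i * z 0 i <= `|z|) ->
  1 - t `^ p <= \sum_(i < n) c i * y 0 i ->
  forall i, `|c i - sgpow (p - 1) (y 0 i)| <= 3 * t `^ (p - 1).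
Proof.
move=> t0 y1 cle cy i; have r0 : 0 < p - 1 by rewrite subr_gt0.
have r1 : p - 1 <= 1 by rewrite lerBlDr.
have [pn0 tn0] := (lt0r_neq0 p0, lt0r_neq0 t0).
(* Dividing by t the one-sided bounds for s = t and s = -t gives both sides of the absolute
   value. *)
suff H s : `|s| = t -> s * (c i - sgpow (p - 1) (y 0 i)) <= 3 * t `^ p.
  have tp : 3 * t `^ p = t * (3 * t `^ (p - 1)).
    by rewrite mulrCA mulr_powRB1// ltW.
  rewrite ler_norml; apply/andP; split; rewrite -(ler_pM2l t0) -?tp.
    have := H (- t); rewrite normrN gtr0_norm// => /(_ erefl).
    by rewrite mulrN -tp; lra.
  by apply: H; rewrite gtr0_norm.
move=> st; pose z : Y := y + s *: lpn_delta (ltW p1) i.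
have zE j : z 0 j = y 0 j + (if j == i then s else 0).
  by rewrite !mxE eqxx/= eq_sym; case: eqP => _; rewrite ?mulr1 ?mulr0.
have cz : \sum_(j < n) c j * z 0 j = \sum_(j < n) c j * y 0 j + s * c i.
  under eq_bigr do rewrite zE mulrDr.
  rewrite big_split/=; congr (_ + _); rewrite (bigD1 i)//= eqxx mulrC big1 ?addr0//.
  by move=> j /negPf ->; rewrite mulr0.
have zp : `|z| `^ p = 1 + (`|y 0 i + s| `^ p - `|y 0 i| `^ p).
  have yp : `|y| `^ p = 1 by rewrite y1 powR1.
  rewrite -[X in _ = X + _]yp [X in X = _]lpn_normp [X in _ = X + _]lpn_normp.
  rewrite (bigD1 i)//= [in RHS](bigD1 i)//= zE eqxx.
  rewrite (eq_bigr (fun j => `|y 0 j| `^ p)); last first.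
    by move=> j /negPf ji; rewrite zE ji addr0.
  by ring.
(* The 3 t^p is the 2 t^p of the smoothness estimate plus the defect t^p in [cy]. *)
have := le_trans (cle z) (powR_ge_id p1 pq (normr_ge0 z)); rewrite cz zp => cz'.
have := le_trans cz' (powR_young_smooth p1 pq (y 0 i) p2 st).
move: cy; move: (\sum_(j < n) _) (t `^ p) (sgpow _ _) (c i).
by clear z zE cz zp cz' cle y1 => *; lra.
Qed.

End lpn_duality.

(** * From octahedrality to almost isometric copies of l_q^n in L_1(mu) *)

Section injtensor_facts.
Context {R : realType} {X Y : normedModType R}.

Lemma injtensor_sumE (I : Type) (s : seq I) (k : I -> R)
    (u : I -> injtensor X Y) f :
  (\sum_(i <- s) k i *: u i : injtensor X Y) f = \sum_(i <- s) k i * u i f.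
Proof. exact: (big_morph (fun v : injtensor X Y => v f)). Qed.

Lemma injtensor_normP (u : injtensor X Y) (e : R) : 0 < e ->
  exists f, `|u| - e < `|u f|.
Proof.
move=> e0; have [_ [f _ <-] uf] := sup_adherent e0 (inj_norm_has_sup u).
by exists f.
Qed.

(** Already E = 0 supplies a unit tensor, which over a trivial X would be within 1/2 of 0. For
    arbitrary [mu] the space L_1(mu) might be trivial, so a unit vector has to be produced. *)
Lemma octahedral_nontrivial : octahedral_norm (injtensor X Y) ->
  exists x : X, `|x| = 1.
Proof.
move=> oct; pose E := [set \sum_(i < 0) c i *: (0 : injtensor X Y)
  | c in [set: 'I_0 -> R]].
have [||y y1 _] := oct E 1; [by exists 0%N, (fun=> 0)|by []|].
have [s ys] := inj_sum_dense y (ltac:(lra) : 0 < 2^-1 :> R).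
have [x x0] : exists x : X, x != 0.
  apply: contrapT => /forallNP X0; move: ys.
  rewrite (_ : inj_sum s = 0) ?subr0 ?y1; first lra.
  apply/val_inj/funext => f /=; rewrite tens_sumE big1// => z _.
  by have /negP/negPn/eqP -> := X0 z.1; rewrite linear0 mul0r.
exists (`|x|^-1 *: x); rewrite normrZ ger0_norm ?invr_ge0//.
by rewrite mulVf// normr_eq0.
Qed.

End injtensor_facts.

(** Here [t] is the step of the smoothness test. The constant collects 5 e <= t^(p-1) and n
    coordinate errors 3 t^(p-1), each weighted by a norm |w_i| <= 2. *)
Lemma octahedral_embedding_sphere d (T : measurableType d) (R : realType)
    (mu : {measure set T -> \bar R}) (p q : R) (n : nat) (p1 : 1 < p)
    (p2 : p <= 2) (pq : p^-1 + q^-1 = 1) (q1 : 1 <= q) (t : R) :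
  0 < t -> t <= 1 ->
  octahedral_norm (injtensor (LspaceType1 mu) (lpn (ltW p1) n)) ->
  exists w : 'I_n -> LspaceType1 mu, forall a : lpn q1 n, `|a| = 1 ->
    1 - (1 + 6 * n%:R) * t `^ (p - 1) <= `|\sum_(i < n) a 0 i *: w i|
      <= 1 + t `^ (p - 1).
Proof.
pose L1 := LspaceType1 mu; pose Y := lpn (ltW p1) n; pose Yd := lpn q1 n.
move=> t0 t1 oct; have [x0 x01] := octahedral_nontrivial oct.
(* With 5 e = t^p the defect 3 e of |g(y)| found below stays within the t^p allowed by
   [lpn_smooth]. *)
have [e etp] : exists e, e * 5 = t `^ p.
  by exists (t `^ p / 5); rewrite divfK ?pnatr_eq0.
have e0 : 0 < e by rewrite -(pmulr_lgt0 _ (ltr0n R 5)) etp powR_gt0.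
have et : e * 5 <= t `^ (p - 1).
  rewrite etp -(mulr_powRB1 (ltW t0) (lt_trans ltr01 p1)).
  by rewrite ler_piMl ?powR_ge0.
have e1 : e * 5 <= 1.
  apply: (le_trans et); rewrite -[leRHS](powRr0 t).
  by apply: ger_powR; rewrite ?t0// subr_ge0 ltW.
have e1' : 0 <= 1 - e by move: e0 e1; clear => *; lra.
have eC : 1 - (1 + 6 * n%:R) * t `^ (p - 1)
    <= 1 - 5 * e - n%:R * (3 * t `^ (p - 1) * 2).
  by rewrite mulrDl mul1r; move: et; clear => *; lra.
pose v i : injtensor L1 Y := inj_sum [:: (x0, lpn_delta (ltW p1) i)].
pose E := [set \sum_(i < n) c i *: v i | c in [set: 'I_n -> R]].
have [u u1 uoct] := oct E e (ex_intro _ n (ex_intro _ v erefl)) e0.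
have [s us] := inj_sum_dense u e0.
(* Expanding the second factors in unit vectors rewrites the finite tensor [s] as the sum of the
   [w i] (x) e_i. *)
pose w i : L1 := \sum_(z <- s) (z.2 : Y) 0 i *: z.1.
have sE f : tens_sum s f = f.1 (\sum_(i < n) f.2 (lpn_delta _ i) *: w i).
  rewrite tens_sumE /w; under [in RHS]eq_bigr do rewrite scaler_sumr.
  rewrite exchange_big/= linear_sum; apply: eq_bigr => z _.
  rewrite [z.2 in LHS]lpn_sum_delta linear_sum linear_sum mulr_sumr.
  apply: eq_bigr => i _; rewrite scalerA !linearZ/=.
  by rewrite /GRing.scale/= mulrC [z.2 0 i * _]mulrC.
have uw f : `|u f - f.1 (\sum_(i < n) f.2 (lpn_delta _ i) *: w i)| <= e.
  by rewrite -sE (le_trans _ us)// (inj_norm_ub (u - inj_sum s) f).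
have formE (a : Yd) i : lpn_form (p1 := p1) a (lpn_delta (ltW p1) i) = a 0 i.
  rewrite /lpn_form (bigD1 i)//= mxE !eqxx mulr1 big1 ?addr0// => j /negPf ji.
  by rewrite mxE ji andbF mulr0.
have upper (a : Yd) : `|a| = 1 -> `|\sum_(i < n) a 0 i *: w i| <= 1 + e.
  (* The norm is attained at [f], and [g] has coordinates [a]; so it is the value of the finite
     tensor at (f, g), within e of a value of the unit tensor [u]. *)
  move=> a1; have [f fa] := L1_norming (\sum_(i < n) a 0 i *: w i).
  pose g := lpn_dual p1 pq a1.
  have := uw (f, g); rewrite /= (eq_bigr (fun i => a 0 i *: w i)); last first.
    by move=> i _; rewrite formE.
  rewrite fa distrC => /(le_trans (lerB_dist _ _)).
  rewrite normr_id => H; have := inj_norm_ub u (f, g).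
  rewrite -[inj_norm u]/(`|u|) u1; move: H.
  by move: (`|u _|) (`|_|); clear => *; lra.
have wn i : `|w i| <= 1 + e.
  have := upper _ (lpn_norm_delta q1 i); rewrite (bigD1 i)//= mxE !eqxx scale1r.
  by rewrite big1 ?addr0// => j /negPf ji; rewrite mxE ji andbF scale0r.
exists w => a a1; apply/andP; split; last first.
  rewrite (le_trans (upper a a1))// lerD2l (le_trans _ et)//.
  by rewrite ler_peMr ?ler1n// ltW.
have [f0 f0x] := L1_norming x0.
pose g0 := lpn_dual p1 pq a1; pose y := dual_vec p1 a.
(* This is x0 (x) y, of norm at least 1 since [f0] norms [x0] and [a] norms [y]. *)
pose x : injtensor L1 Y := \sum_(i < n) y 0 i *: v i.
have xE f : x f = f.1 x0 * f.2 y.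
  rewrite injtensor_sumE [y in RHS]lpn_sum_delta linear_sum mulr_sumr.
  apply: eq_bigr => i _; rewrite linearZ/=.
  by rewrite tens_sumE big_seq1/= [RHS]mulrCA.
have x1 : 1 <= `|x|.
  have := inj_norm_ub x (f0, g0).
  by rewrite xE/= f0x x01 mul1r lpn_form_dual_vec// normr1.
have Ex : E x by exists (fun i => y 0 i).
have := uoct x 1 Ex; rewrite scale1r normr1 => xu.
have xu2 : 2 - 2 * e <= `|x + u|.
  rewrite (le_trans _ xu)// (_ : 2 - 2 * e = (1 - e) * 2); last by ring.
  by rewrite ler_wpM2l// -[2]/(1 + 1) lerD2r.
have [[f g]] := injtensor_normP (x + u) e0.
rewrite -[(x + u) _]/(x (f, g) + u (f, g)) xE/=.
set W := f (\sum_(i < n) g (lpn_delta (ltW p1) i) *: w i).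
have uW : `|u (f, g) - W| <= e := uw (f, g).
have u1' : `|u (f, g)| <= 1.
  by have := inj_norm_ub u (f, g); rewrite -[inj_norm u]/(`|u|) u1.
move=> big; have big2 := lt_le_trans big (ler_normD _ _).
have fg : `|f x0 * g y| <= `|g y|.
  by rewrite normrM ler_piMl// (le_trans (dual_ballP f x0))// x01.
have y1 : `|y| = 1 by exact: norm_dual_vec.
have gy1 : `|g y| <= 1 by rewrite (le_trans (dual_ballP g y))// y1.
(* Two numbers at most 1 with sum above 2 - 3 e both exceed 1 - 3 e. *)
have [gy ufg] : 1 - 3 * e < `|g y| /\ 1 - 3 * e < `|u (f, g)|.
  move: xu2 big2 fg gy1 u1'.
  move: `|x + u| `|f x0 * g y| `|g y| `|u (f, g)|; clear.
  by move=> *; split; lra.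
have W1 : 1 - 5 * e <= `|W|.
  have := ler_normD (u (f, g) - W) W; rewrite subrK; move: uW ufg e0.
  by move: `|u (f, g) - W| `|W| `|u (f, g)|; clear => *; lra.
(* Correcting [g] by the sign of g(y) makes its value at [y] equal to |g(y)|, close to 1, so
   smoothness puts [c] near [a]. *)
pose c i : R := Num.sg (g y) * g (lpn_delta (ltW p1) i).
have cE (z : Y) : \sum_(i < n) c i * z 0 i = Num.sg (g y) * g z.
  rewrite [z in RHS]lpn_sum_delta linear_sum mulr_sumr.
  by apply: eq_bigr => i _; rewrite linearZ/= /c mulrAC mulrA.
have g0y : Num.sg (g y) != 0.
  rewrite sgr_eq0 -normr_gt0 (le_lt_trans _ gy)//.
  by move: e0 e1; clear => *; lra.
have cn (z : Y) : \sum_(i < n) c i * z 0 i <= `|z|.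
  rewrite cE (le_trans (ler_norm _))// normrM normr_sg.
  by rewrite -sgr_eq0 g0y mul1r dual_ballP.
have cy : 1 - t `^ p <= \sum_(i < n) c i * y 0 i.
  rewrite cE -normrEsg -etp (le_trans _ (ltW gy))//.
  by move: e0; clear => *; lra.
have ca i : `|c i - a 0 i| <= 3 * t `^ (p - 1).
  by have := lpn_smooth p2 pq t0 y1 cn cy i; rewrite sgpow_dual_vec.
have cW : `|W| <= `|\sum_(i < n) c i *: w i|.
  rewrite (le_trans _ (dual_ballP f _))// (_ : f _ = Num.sg (g y) * W).
    by rewrite normrM normr_sg -sgr_eq0 g0y mul1r.
  rewrite -[_ * W]/(Num.sg (g y) *: (W : R^o)) -linearZ scaler_sumr.
  by congr (f _); apply: eq_bigr => i _; rewrite scalerA.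
have cwa : `|\sum_(i < n) c i *: w i| <= `|\sum_(i < n) a 0 i *: w i|
    + n%:R * (3 * t `^ (p - 1) * 2).
  rewrite -[X in `|X|](subrK (\sum_(i < n) a 0 i *: w i)) addrC.
  rewrite (le_trans (ler_normD _ _))// lerD2l -sumrB.
  rewrite (le_trans (ler_norm_sum _ _ _))//.
  rewrite mulr_natl -[X in _ *+ X]card_ord -sumr_const ler_sum// => i _.
  rewrite -scalerBl normrZ ler_pM// (le_trans (wn i))//.
  by move: e0 e1; clear => *; lra.
rewrite (le_trans eC)// lerBlDr (le_trans W1)//.
exact: le_trans cW cwa.
Qed.

Section embedding.
Context d {T : measurableType d} {R : realType}.
Variable mu : {measure set T -> \bar R}.
Local Notation L1 := (LspaceType1 mu).
Context {p q : R} (n : nat).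
Hypotheses (p1 : 1 < p) (p2 : p <= 2) (pq : p^-1 + q^-1 = 1).
Variable q1 : 1 <= q.

Lemma octahedral_embedding (e : R) : 0 < e ->
  octahedral_norm (injtensor L1 (lpn (ltW p1) n)) ->
  exists w : 'I_n -> L1, forall a : lpn q1 n,
    (1 - e) * `|a| <= `|\sum_(i < n) a 0 i *: w i| <= (1 + e) * `|a|.
Proof.
move=> e0 oct; pose C : R := 1 + 6 * n%:R.
have C1 : 1 <= C by rewrite lerDl mulr_ge0.
have C0 : 0 < C by exact: lt_le_trans C1.
have r0 : 0 < p - 1 by rewrite subr_gt0.
(* The aim is t^(p-1) = m with C m <= e; the minimum with 1 ensures t <= 1. Homogeneity then leaves
   the sphere. *)
pose m := Num.min 1 (e / C).
have m0 : 0 < m by rewrite lt_min ltr01/= divr_gt0.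
pose t := m `^ (p - 1)^-1.
have t0 : 0 < t by rewrite powR_gt0.
have tm : t `^ (p - 1) = m by rewrite -powRrM mulVf ?powRr1 ?ltW ?gt_eqF.
have t1 : t <= 1.
  apply: (@le_trans _ _ (1 `^ (p - 1)^-1)); last by rewrite powR1.
  by apply: ge0_ler_powR; rewrite ?nnegrE ?invr_ge0 ?(ltW r0) ?(ltW m0)// ge_min lexx.
have [w wP] := octahedral_embedding_sphere p2 pq q1 t0 t1 oct.
have Cm : C * m <= e by rewrite mulrC -ler_pdivlMr// ge_min lexx orbT.
have me : m <= e by rewrite (le_trans _ Cm)// ler_peMl// ltW.
exists w => a; have [->|a0] := eqVneq a 0.
  rewrite normr0 !mulr0 big1 ?normr0 ?lexx// => i _.
  by rewrite mxE scale0r.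
have na0 : 0 < `|a| by rewrite normr_gt0.
have na : `| `|a|^-1 *: a | = 1.
  by rewrite normrZ ger0_norm ?invr_ge0// mulVf// gt_eqF.
have := wP _ na; rewrite tm.
have -> : \sum_(i < n) (`|a|^-1 *: a) 0 i *: w i
    = `|a|^-1 *: \sum_(i < n) a 0 i *: w i.
  by rewrite scaler_sumr; apply: eq_bigr => i _; rewrite mxE scalerA.
rewrite normrZ ger0_norm ?invr_ge0// [_^-1 * _]mulrC ler_pdivrMr// ler_pdivlMr//.
move=> /andP[lo hi]; apply/andP; split.
  by rewrite (le_trans _ lo)// ler_wpM2r// lerD2l lerN2.
by rewrite (le_trans hi)// ler_wpM2r// lerD2l.
Qed.

End embedding.

(** * Second differences of the absolute value over a grid *)

Section grid.
Context {R : realType}.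
Implicit Types (x y z t : R) (N : nat).

(** For j = 0, ..., 2N the points run from -1 to 1 in steps of 1/N, so 2N + 1 indices are used. *)
Definition grid N (j : nat) : R := j%:R / N%:R - 1.

Lemma grid_approx N v : (0 < N)%N -> `|v| <= 1 ->
  exists j : 'I_(2 * N).+1, `|v - grid N j| <= N%:R^-1.
Proof.
move=> N0; rewrite ler_norml => /andP[v1 v2].
have N0' : 0 < N%:R :> R by rewrite ltr0n.
pose u := (v + 1) * N%:R.
have u0 : 0 <= u by rewrite mulr_ge0//; lra.
have /andP[ju uj] := truncn_itv u0; set j := Num.truncn u in ju uj.
have jN : (j < (2 * N).+1)%N.
  rewrite ltnS -(ler_nat R) (le_trans ju)// natrM ler_wpM2r//; lra.
exists (Ordinal jN); rewrite /grid/=.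
have -> : v - (j%:R / N%:R - 1) = (u - j%:R) / N%:R.
  by rewrite /u; field; exact: lt0r_neq0.
rewrite normrM [`|_^-1|]gtr0_norm ?invr_gt0// ler_piMl ?invr_ge0//.
rewrite ger0_norm ?subr_ge0//; move: uj; rewrite -natr1; lra.
Qed.

(** As |x| <= |y|, the zero -x / y of s |-> x + s y lies in [-1, 1]; rounding it to the grid changes
    the value by at most |y| / N. *)
Lemma grid_lin_approx N x y : (0 < N)%N -> `|x| <= `|y| ->
  exists j : 'I_(2 * N).+1, `|x + grid N j * y| <= `|y| / N%:R.
Proof.
move=> N0 xy; have [y0|y0] := eqVneq y 0.
  move: xy; rewrite y0 normr0 normr_le0 => /eqP ->.
  by exists ord0; rewrite mulr0 addr0 normr0 mul0r.
have [|j jP] := @grid_approx N (- x / y) N0.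
  by rewrite normrM normrN normfV ler_pdivrMr ?mul1r// normr_gt0.
exists j; rewrite (_ : x + _ = - y * (- x / y - grid N j)); last by field.
by rewrite normrM normrN ler_wpM2l.
Qed.

Let D t z x := `|x + t * z| + `|x - t * z| - 2 * `|x|.

Let D_ge0 t z x : 0 <= D t z x.
Proof.
have := ler_normD (x + t * z) (x - t * z).
by rewrite addrACA subrr addr0 -mulr2n normrMn -mulr_natl /D; lra.
Qed.

Let D_ge t z x : 0 <= t -> 2 * (t * `|z| - `|x|) <= D t z x.
Proof.
move=> t0; have := ler_normB (x + t * z) (x - t * z).
rewrite (_ : x + t * z - (x - t * z) = 2 * (t * z)); last by ring.
by rewrite normrM (normrM t) (ger0_norm t0) ger0_norm// /D; lra.
Qed.

(* Some grid point is almost orthogonal to (x, y), and there the second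
   difference in the direction of z detects t * |z|. *)
Lemma grid_second_difference N t x y z : (0 < N)%N -> 0 <= t ->
  2 * (t * `|z| - (`|x| + `|y|) / N%:R) <=
  \sum_(j < (2 * N).+1) D t z (x + grid N j * y) +
  \sum_(j < (2 * N).+1) D t z (y + grid N j * x).
Proof.
(* Exchanging x and y exchanges the two sums, which is why both families of points are present. *)
move=> N0 t0; wlog xy : x y / `|x| <= `|y|.
  move=> H; have [|/ltW] := leP `|x| `|y|; first exact: H.
  by move=> /H; rewrite [X in _ <= X -> _]addrC [X in X / _]addrC.
have [j jP] := grid_lin_approx N0 xy.
rewrite -[leLHS]addr0 lerD//; last by rewrite sumr_ge0// => i _; exact: D_ge0.
rewrite (bigD1 j)//= -[leLHS]addr0 lerD//; last first.
  by rewrite sumr_ge0// => i _; exact: D_ge0.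
rewrite (le_trans _ (D_ge _ _ t0))// ler_pM2l// lerD2l lerN2.
rewrite (le_trans jP)// ler_wpM2r ?invr_ge0//; have := normr_ge0 x; lra.
Qed.

End grid.

(** * Grid vectors in l_q^n and their perturbation by a disjoint unit vector *)

Section lpn_coordinates.
Context {R : realType} {q : R} (q1 : 1 <= q) (n : nat).
Implicit Types x y : lpn q1 n.

Lemma lpn_normp_addZ x i t : x 0 i = 0 ->
  `|x + t *: lpn_delta q1 i| `^ q = `|x| `^ q + `|t| `^ q.
Proof.
move=> xi; rewrite [X in X = _]lpn_normp [X in _ = X + _]lpn_normp.
rewrite [X in X = _](bigD1 i)//= [X in _ = X + _](bigD1 i)//= xi.
rewrite normr0 powR0 ?gt_eqF ?(lt_le_trans ltr01 q1)// add0r addrC.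
congr (_ + _); last by rewrite !mxE !eqxx xi mulr1 add0r.
by apply: eq_bigr => j /negPf ji; rewrite !mxE ji andbF mulr0 addr0.
Qed.

Lemma lpn_norm_addZ_ge x i t : x 0 i = 0 -> `|x| <= `|x + t *: lpn_delta q1 i|.
Proof.
move=> xi; rewrite leNgt; apply/negP => h.
have := gt0_ltr_powR (lt_le_trans ltr01 q1) (normr_ge0 _) (normr_ge0 _) h.
by rewrite [X in X < _](lpn_normp_addZ t xi) gtrDl ltNge powR_ge0.
Qed.

(** With r = |x| and h = |t|^q the claim is r^q + h <= (r + h)^q. Splitting off one factor r + h, it
    follows from (r + h)^(q-1) >= r^(q-1) and, as r >= 1, (r + h)^(q-1) >= 1. *)
Lemma lpn_norm_addZ_le x i t : x 0 i = 0 -> 1 <= `|x| ->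
  `|x + t *: lpn_delta q1 i| <= `|x| + `|t| `^ q.
Proof.
move=> xi x1; have q0 := lt_le_trans ltr01 q1.
rewrite leNgt; apply/negP => h.
have := gt0_ltr_powR q0 (addr_ge0 (normr_ge0 x) (powR_ge0 `|t| q)) (normr_ge0 _) h.
rewrite [X in _ < X](lpn_normp_addZ t xi) ltNge => /negP; apply.
move: (normr_ge0 x) x1 (powR_ge0 `|t| q) {h}.
move: `|x| (`|t| `^ q) => r h r0 r1 h0; have rh0 := addr_ge0 r0 h0.
rewrite -[leRHS](mulr_powRB1 rh0 q0) mulrDl lerD//.
  rewrite -(mulr_powRB1 r0 q0) ler_wpM2l// ge0_ler_powR ?nnegrE ?subr_ge0 ?addr_ge0//.
  by rewrite lerDl.
rewrite ler_peMr//; apply: (@le_trans _ _ (1 `^ (q - 1))); first by rewrite powR1.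
apply: ge0_ler_powR; rewrite ?nnegrE ?subr_ge0 ?addr_ge0//.
by rewrite (le_trans r1)// lerDl.
Qed.

End lpn_coordinates.

Section grid_vectors.
Context {R : realType} {q : R} (q1 : 1 <= q) (n : nat).
Implicit Types (i j k : 'I_n) (s t : R).

Definition edge i j s : lpn q1 n := lpn_delta q1 i + s *: lpn_delta q1 j.

Lemma lpn_deltaE i j : (lpn_delta q1 i : 'rV[R]_n) 0 j = (i == j)%:R.
Proof. by rewrite mxE eqxx eq_sym. Qed.

Lemma edge_norm_ge1 i j s : i != j -> 1 <= `|edge i j s|.
Proof.
move=> /negPf ij; rewrite -[leLHS](lpn_norm_delta q1 i).
by apply: lpn_norm_addZ_ge; rewrite lpn_deltaE ij.
Qed.

Lemma edge_norm_le2 i j s : `|s| <= 1 -> `|edge i j s| <= 2.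
Proof.
move=> s1; rewrite (le_trans (ler_normD _ _))// normrZ !lpn_norm_delta.
by rewrite mulr1 -[2]/(1 + 1) lerD2l.
Qed.

Lemma edge_norm_addZ i j k s t : i != j -> i != k -> j != k ->
  `|edge i j s + t *: lpn_delta q1 k| <= `|edge i j s| + `|t| `^ q.
Proof.
move=> ij /negPf ik /negPf jk; apply: lpn_norm_addZ_le; last exact: edge_norm_ge1.
by rewrite mxE [X in _ + X]mxE !lpn_deltaE ik jk mulr0 addr0.
Qed.

Lemma row_form_delta (xi : 'I_n -> R) k :
  \sum_i (lpn_delta q1 k : 'rV[R]_n) 0 i * xi i = xi k.
Proof.
rewrite (bigD1 k)//= lpn_deltaE eqxx mul1r big1 ?addr0// => i ik.
by rewrite lpn_deltaE eq_sym (negPf ik) mul0r.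
Qed.

Lemma row_formDZ (xi : 'I_n -> R) (x y : lpn q1 n) t :
  \sum_i (x + t *: y : 'rV[R]_n) 0 i * xi i =
  \sum_i x 0 i * xi i + t * \sum_i y 0 i * xi i.
Proof.
rewrite mulr_sumr -big_split; apply: eq_bigr => i _.
by rewrite !mxE mulrDl mulrA.
Qed.

(** Up to sign, these points run around the boundary of the square [-1, 1]^2 in the (e_i,
    e_j)-plane. *)
Definition grid_edge i j (N : nat) (g : bool * 'I_(2 * N).+1) : lpn q1 n :=
  if g.1 then edge i j (grid N g.2) else edge j i (grid N g.2).

End grid_vectors.

Lemma grid_norm_le1 (R : realType) N (k : 'I_(2 * N).+1) :
  (0 < N)%N -> `|grid N k : R| <= 1.
Proof.
move=> N0; have N0' : 0 < N%:R :> R by rewrite ltr0n.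
have kN : (k%:R : R) <= 2 * N%:R by rewrite -natrM ler_nat -ltnS.
have h1 : 0 <= (k%:R : R) / N%:R by rewrite divr_ge0.
have h2 : (k%:R : R) / N%:R <= 2 by rewrite ler_pdivrMr.
by rewrite /grid ler_norml; apply/andP; split; lra.
Qed.

(** * The grid inequality in L_1(mu) and the contradiction *)

Section L1_grid.
Context d {T : measurableType d} {R : realType}.
Variable mu : {measure set T -> \bar R}.
Context {q : R} (q1 : 1 <= q) (n : nat) (w : 'I_n -> LspaceType1 mu).

Definition L1_comb (v : lpn q1 n) : LspaceType1 mu := \sum_m v 0 m *: w m.

(** [grid_second_difference] involves only absolute values of linear forms in (x, y, z), so it
    integrates to L_1(mu). *)
Lemma L1_grid_inequality (i j k : 'I_n) (N : nat) (t : R) :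
  (0 < N)%N -> 0 <= t ->
  2 * (t * `|L1_comb (lpn_delta q1 k)| -
    (`|L1_comb (lpn_delta q1 i)| + `|L1_comb (lpn_delta q1 j)|) / N%:R) <=
  \sum_(g : bool * 'I_(2 * N).+1)
    (`|L1_comb (grid_edge q1 i j g + t *: lpn_delta q1 k)| +
     `|L1_comb (grid_edge q1 i j g + - t *: lpn_delta q1 k)| -
     2 * `|L1_comb (grid_edge q1 i j g)|).
Proof.
move=> N0 t0; pose K := (bool * 'I_(2 * N).+1)%type; pose G := index_enum K.
pose x (g : K) := grid_edge q1 i j g.
(* Weights and vectors of both sides, in one list, so that the inequality becomes nonnegativity of a
   single weighted sum of norms. *)
pose S : seq (R * lpn q1 n) :=
  [seq (1, x g + t *: lpn_delta q1 k) | g <- G] ++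
  [seq (1, x g + - t *: lpn_delta q1 k) | g <- G] ++
  [seq (- 2, x g) | g <- G] ++
  [:: (2 / N%:R, lpn_delta q1 i); (2 / N%:R, lpn_delta q1 j);
      (- (2 * t), lpn_delta q1 k)].
have SE (F : lpn q1 n -> R) : \sum_(a <- S) a.1 * F a.2 =
    \sum_(g : K) (F (x g + t *: lpn_delta q1 k) +
      F (x g + - t *: lpn_delta q1 k) - 2 * F (x g)) -
    2 * (t * F (lpn_delta q1 k) -
      (F (lpn_delta q1 i) + F (lpn_delta q1 j)) / N%:R).
  rewrite !big_cat !big_cons big_nil !big_map/= -!mulr_sumr.
  by rewrite !big_split/= sumrN -mulr_sumr; ring.
have := @L1_norm_lincomb_ge0 _ T R mu _ _ S (index_enum 'I_n)
  (fun a => a.1) (fun a m => a.2 0 m) w.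
rewrite (SE (fun v => `|L1_comb v|)) subr_ge0; apply=> xi.
rewrite (SE (fun v => `|\sum_m v 0 m * xi m|)) subr_ge0 !row_form_delta.
apply: le_trans (grid_second_difference (xi i) (xi j) (xi k) N0 t0) _.
rewrite le_eqVlt; apply/orP; left; apply/eqP.
rewrite -(pair_bigA _ (fun b l =>
  `|\sum_m (x (b, l) + t *: lpn_delta q1 k) 0 m * xi m| +
  `|\sum_m (x (b, l) + - t *: lpn_delta q1 k) 0 m * xi m| -
  2 * `|\sum_m x (b, l) 0 m * xi m|))/= big_bool/=.
by congr (_ + _); apply: eq_bigr => l _;
  rewrite !row_formDZ !row_form_delta mulNr.
Qed.

End L1_grid.

(** All effects of the distortion stand on the right with a factor [e], so that [e] can tend to 0
    with [N] and [t] fixed. *)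
Lemma embedding_grid_bound d (T : measurableType d) (R : realType)
    (mu : {measure set T -> \bar R}) (q : R) (q1 : 1 <= q) (n : nat)
    (i j k : 'I_n) (ij : i != j) (ik : i != k) (jk : j != k)
    (w : 'I_n -> LspaceType1 mu) (N : nat) (t e : R) :
  (0 < N)%N -> 0 <= t -> 0 < e ->
  (forall a : lpn q1 n, (1 - e) * `|a| <= `|L1_comb w a| <= (1 + e) * `|a|) ->
  t - 2 / N%:R - 2 * (2 * N).+1%:R * t `^ q <=
  e * (t + 2 / N%:R + 2 * (2 * N).+1%:R * (t `^ q + 4)).
Proof.
move=> N0 t0 e0 wP.
have lo (a : lpn q1 n) : (1 - e) * `|a| <= `|L1_comb w a|.
  exact: (proj1 (andP (wP a))).
have up (a : lpn q1 n) : `|L1_comb w a| <= (1 + e) * `|a|.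
  exact: (proj2 (andP (wP a))).
have ji : j != i by rewrite eq_sym ij.
(* With r = |v| <= 2, each second difference is at most 2 (1 + e) (r + t^q) - 2 (1 - e) r <= 2 (1 +
   e) t^q + 8 e. *)
have Bsum : \sum_(g : bool * 'I_(2 * N).+1)
    (`|L1_comb w (grid_edge q1 i j g + t *: lpn_delta q1 k)| +
     `|L1_comb w (grid_edge q1 i j g + - t *: lpn_delta q1 k)| -
     2 * `|L1_comb w (grid_edge q1 i j g)|) <=
    (2 * (2 * N).+1)%:R * (2 * ((1 + e) * t `^ q + 4 * e)).
  have cK : #|{: bool * 'I_(2 * N).+1}| = (2 * (2 * N).+1)%N.
    by rewrite card_prod card_bool card_ord.
  rewrite mulr_natl -cK.
  rewrite -sumr_const ler_sum// => g _.
  have g2 : `|grid_edge q1 i j g| <= 2.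
    by rewrite /grid_edge; case: g.1; apply: edge_norm_le2; exact: grid_norm_le1.
  have gt s : `|s| = t ->
      `|grid_edge q1 i j g + s *: lpn_delta q1 k| <= `|grid_edge q1 i j g| + t `^ q.
    by move=> <-; rewrite /grid_edge; case: g.1; exact: edge_norm_addZ.
  have e1 : 0 <= 1 + e by move: e0; clear => *; lra.
  have tp : `|t| = t by rewrite ger0_norm.
  have tn : `|- t| = t by rewrite normrN.
  have := le_trans (up _) (ler_wpM2l e1 (gt _ tp)).
  have := le_trans (up _) (ler_wpM2l e1 (gt _ tn)).
  have := lo (grid_edge q1 i j g).
  have := ler_wpM2l (ltW e0) g2.
  move: `|L1_comb w (_ + t *: _)| `|L1_comb w (_ + - t *: _)|.
  move: `|L1_comb w _| `|grid_edge q1 i j g| (t `^ q).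
  by clear => *; lra.
have := le_trans (L1_grid_inequality q1 w i j k N0 t0) Bsum; rewrite natrM.
have Ni0 : 0 <= N%:R^-1 :> R by rewrite invr_ge0.
have := ler_wpM2l t0 (lo (lpn_delta q1 k)).
have := ler_wpM2r Ni0 (up (lpn_delta q1 i)).
have := ler_wpM2r Ni0 (up (lpn_delta q1 j)); rewrite !lpn_norm_delta !mulr1.
move: `|L1_comb w (lpn_delta q1 i)| `|L1_comb w (lpn_delta q1 j)|.
move: `|L1_comb w (lpn_delta q1 k)| (N%:R^-1) ((2 * N).+1%:R) (t `^ q).
by clear => *; lra.
Qed.

(** For t = 4 / N one has t - 2 / N = 2 / N, while the last term is at most 6 4^q N^(1-q). The
    difference is positive once N^(q-2) > 3 4^q, which a large N achieves as q > 2. *)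
Lemma grid_size_choice (R : realType) (q : R) : 2 < q ->
  exists (N : nat) (t : R), [/\ (0 < N)%N, 0 <= t &
    0 < t - 2 / N%:R - 2 * (2 * N).+1%:R * t `^ q].
Proof.
move=> q2; pose C : R := 3 * 4 `^ q + 1.
have C1 : 1 <= C by rewrite lerDr mulr_ge0 ?powR_ge0.
have C0 : 0 < C by exact: lt_le_trans C1.
have q0 : 0 < q - 2 by rewrite subr_gt0.
pose N := (Num.truncn (C `^ (q - 2)^-1)).+1.
have NC : C `^ (q - 2)^-1 <= N%:R by rewrite ltW// truncnS_gt.
have N0 : 0 < N%:R :> R by rewrite ltr0n.
exists N, (4 / N%:R); split=> //.
have CN : C <= N%:R `^ (q - 2).
  have {1}-> : C = (C `^ (q - 2)^-1) `^ (q - 2).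
    by rewrite -powRrM mulVf ?lt0r_neq0// powRr1 ?ltW.
  by apply: ge0_ler_powR; rewrite ?nnegrE ?powR_ge0 ?(ltW q0) ?(ltW N0).
have NqE : N%:R `^ q = N%:R ^+ 2 * N%:R `^ (q - 2).
  rewrite -powR_mulrn ?(ltW N0)// -powRD ?(gt_eqF N0) ?implybT//.
  by congr (_ `^ _); ring.
have tE : (4 / N%:R) `^ q = 4 `^ q / (N%:R ^+ 2 * N%:R `^ (q - 2)).
  rewrite powRM ?invr_ge0 ?(ltW N0)// -NqE; congr (_ * _).
  by rewrite -(powR_inv1 (ltW N0)) powRAC powR_inv1 ?powR_ge0.
have P0 : 0 < N%:R `^ (q - 2) by rewrite powR_gt0.
rewrite tE (_ : _ - _ - _ =
    (2 * N%:R * N%:R `^ (q - 2) - 2 * (2 * N).+1%:R * 4 `^ q)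
    / (N%:R ^+ 2 * N%:R `^ (q - 2))); last first.
  by field; rewrite !lt0r_neq0.
rewrite divr_gt0 ?mulr_gt0 ?exprn_gt0//.
have N1 : 1 <= N%:R :> R by rewrite ler1n.
have F0 : 0 <= 4 `^ q :> R by exact: powR_ge0.
rewrite -[(2 * N).+1%:R]natr1 natrM subr_gt0.
rewrite /C in CN.
have := ler_wpM2l (ltW N0) CN; have := ler_wpM2r F0 N1.
move: (4 `^ q) (N%:R `^ (q - 2)) (N%:R) N0 => F P M; clear => *; lra.
Qed.

(** An arbitrary measure covers counting measure on the naturals and Lebesgue measure on [0, 1] at
    once. *)
Lemma octahedral_injtensor_L1_lpn d (T : measurableType d) (R : realType)
    (mu : {measure set T -> \bar R}) (p : R) (n : nat) (p1 : 1 < p) :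
  p < 2 -> (3 <= n)%N ->
  ~ octahedral_norm (injtensor (LspaceType1 mu) (lpn (ltW p1) n)).
Proof.
move=> p2 n3 oct; have p0 : 0 < p - 1 by rewrite subr_gt0.
have pn0 : p != 0 by rewrite gt_eqF// (lt_trans ltr01).
pose q := p / (p - 1).
have pq : p^-1 + q^-1 = 1 by rewrite /q; field; rewrite pn0 gt_eqF.
have q2 : 2 < q by rewrite ltr_pdivlMr//; lra.
have q1 : 1 <= q by lra.
have [N [t [N0 t0]]] := grid_size_choice q2.
rewrite ltNge => /negP; apply.
set B := t + 2 / N%:R + 2 * (2 * N).+1%:R * (t `^ q + 4).
have B0 : 0 < B.
  by rewrite ltr_wpDl ?addr_ge0 ?mulr_gt0 ?divr_ge0 ?ltr_wpDl ?powR_ge0.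
(* As [N] and [t] do not depend on [e], embeddings with error e / B show that the positive quantity
   is at most every e > 0. *)
apply/ler_addgt0Pl => e e0; rewrite addr0 -(divfK (lt0r_neq0 B0) e).
have eB0 : 0 < e / B by rewrite divr_gt0.
have [w wP] := octahedral_embedding (ltW p2) pq q1 eB0 oct.
pose o (m : nat) (hm : (m < 3)%N) : 'I_n := Ordinal (leq_trans hm n3).
exact: (@embedding_grid_bound _ _ _ _ _ _ _ (@o 0%N isT) (@o 1%N isT) (@o 2%N isT)
  isT isT isT w).
Qed.

Unset Implicit Arguments.

Theorem theorem3p8 (R : realType) (p : R) (n : nat)
    (p1 : 1 < p) (p2 : p < 2) (n3 : (3 <= n)%N) :
  ~ octahedral_norm (injtensor (ell1 R) (lpn (ltW p1) n)) /\
  ~ octahedral_norm (injtensor (L1_01 R) (lpn (ltW p1) n)).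
Proof. by split; exact: octahedral_injtensor_L1_lpn. Qed.
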